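(* Let $T>0$, $w>0$, $y>0$, $\beta>0$, $r\ge0$, and let $\delta,\rho,\alpha>0$ satisfy $\rho\ne1$, $\rho<\frac1\alpha\neq1$ and $r+\frac{\beta}{\alpha}-\delta>0$. Consider the problem of maximizing the Epstein–Zin recursive utility $U^C_0$ over $C\in\mathcal{A}(w)$ (see context). Set $$\bar\tau=\begin{cases}T-\dfrac{1}{\delta+\beta(1-\frac1\alpha)}\ln\dfrac{r+\beta}{r+\frac\beta\alpha-\delta},&\delta+\beta(1-\frac1\alpha)\ne0,\\[2mm] T-\dfrac1{r+\beta},&\text{otherwise},\end{cases}$$ and suppose $\bar\tau>0$. Let $$k^*=\begin{cases}\dfrac{r+\frac\beta\alpha-\delta}{\beta\left(\delta-(1-\frac1\alpha)r\right)}\left(1-e^{-[\alpha\delta+(1-\alpha)r]\bar\tau}\right),&\delta\ne(1-\frac1\alpha)r,\\[2mm]\left(1-\dfrac{\alpha(\delta-r)}{\beta}\right)\bar\tau,&\text{otherwise}.\end{cases}$$ If $w\ge k^*y$, it is optimal to have an initial consumption gulp of size $\Delta C_0=(w-k^*y)/(1+\beta k^* )$ and then, for $t\in(0,\bar\tau]$, to consume at rates $$dC_t=\left(1-\frac{\alpha(\delta-r)}{\beta}\right)\frac{y+\beta w}{1+\beta k^*}\,e^{-\alpha(\delta-r)t}\,dt$$ (with no consumption after $\bar\tau$). If $w<k^*y$, the investor optimally waits (does not consume) until time $$\underline\tau=\frac{1}{r+\frac\beta\alpha-\delta}\ln\left(M^*\frac{r+\beta}{\beta}\,y^{\frac1\alpha}\right),$$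 and then starts to consume at rates $$dC_t=\frac{\beta+\alpha(r-\delta)}{\beta}\left(M^*\frac{r+\beta}{\beta}\right)^{-\alpha}e^{-\alpha(\delta-r)t}\,dt$$ until time $\bar\tau$ (with no consumption afterwards). Here $M^*=(\beta K^* )/(r+\beta)$, where $K^*>0$ is the unique solution $K$ of $$K^{-\frac{r+\beta}{r+\frac\beta\alpha-\delta}}\,y^{-\frac{\alpha\delta-(\alpha-1)r}{\beta+\alpha(r-\delta)}}-K^{-\alpha}e^{-[\alpha\delta-(\alpha-1)r]\bar\tau}=\frac{\beta[\alpha\delta-(\alpha-1)r]}{\beta+\alpha(r-\delta)}\,w$$ if $\delta\ne(1-\frac1\alpha)r$, or of $$K^{-\alpha}\left(\frac1\beta\ln K+\frac1{\alpha\beta}\ln y-\Bigl(r+\frac\beta\alpha-\delta\Bigr)\bar\tau\right)=-\alpha w$$ if $\delta=(1-\frac1\alpha)r$.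
   Context: $\mathcal{X}$ is the set of nondecreasing, right-continuous functions $C:[0,T]\to[0,\infty)$, with the convention $C_{0-}:=0$ (so $\Delta C_0=C_0$ is an initial gulp, i.e. a point mass of $dC$ at $0$). Integrals with respect to $dC$ are over closed intervals. The price is $e^{-rt}$ and the budget set is $\mathcal{A}(w)=\{C\in\mathcal{X}:\int_0^Te^{-rt}\,dC_t\le w\}$. The level of satisfaction is $$Y^C_t=ye^{-\beta t}+\beta\int_0^te^{-\beta(t-s)}\,dC_s .$$ The Epstein–Zin aggregator is $$f(t,y,u)=\frac{\delta}{1-\frac1\alpha}\,y^{1-\frac1\alpha}\,[(1-\rho)u]^{1-\frac1\psi}-\delta\psi u,\qquad \psi=\frac{1-\rho}{1-\frac1\alpha},$$ and the associated recursive utility, satisfying $U^C_t=\int_t^Tf(s,Y^C_s,U^C_s)\,ds$, is $$U^C_t=\frac{1}{1-\rho}\left(\int_t^T\delta e^{\delta(t-s)}(Y^C_s)^{1-\frac1\alpha}\,ds\right)^{\psi}.$$ A plan $C\in\mathcal{A}(w)$ is optimal if $U^C_0=\sup_{C'\in\mathcal{A}(w)}U^{C'}_0$.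
   Formalization: In the case δ=(1−1/α)r the printed equation for K* is false (the plan then violates the budget); it is replaced by K^{-α}((1/β)ln K + (1/(αβ))ln y − (1/β)(r+β/α−δ)τ̄) = −w/α. *)

(* Defs.v *)
From HB Require Import structures.
From mathcomp Require Import all_boot all_order all_algebra.
From mathcomp Require Import all_classical all_reals all_analysis.
Import Order.TTheory GRing.Theory Num.Theory.
Import numFieldNormedType.Exports.
Set Implicit Arguments.
Unset Strict Implicit.
Unset Printing Implicit Defensive.
Local Open Scope classical_set_scope.
Local Open Scope ring_scope.

(* The set X. Only the values on [0, T] matter. *)
Record plan (R : realType) (T : R) (T_gt0 : 0 < T) := Plan {
  plan_fun :> R -> R ;
  plan_ge0 : forall t, 0 <= t <= T -> 0 <= plan_fun t ;
  plan_nd : forall s t, 0 <= s -> s <= t -> t <= T ->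
    plan_fun s <= plan_fun t ;
  plan_rc : forall t, 0 <= t < T -> plan_fun x @[x --> t^'+] --> plan_fun t }.

Section PlanMeasure.
Context (R : realType) (T : R) (T_gt0 : 0 < T).
Implicit Types C : plan T_gt0.

(* The value 0 before time 0 is the convention C_{0-} = 0: the measure has an
   atom of mass C 0 at 0. It does not charge ]T, +oo[. *)
Definition plan_ext C (t : R) : R :=
  if t < 0 then 0 else C (Num.min t T).

Lemma plan_ext_nd C : nondecreasing (plan_ext C).
Proof.
move=> s t st; rewrite /plan_ext.
have [s0|s0] := ltP s 0; have [t0|t0] := ltP t 0 => //.
- apply: plan_ge0; rewrite le_min t0 ltW//= ge_min lexx orbT //.
- by move: t0; rewrite ltNge (le_trans s0 st).
- apply: plan_nd.
  + by rewrite le_min s0 ltW.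
  + by rewrite le_min !ge_min st lexx orbT.
  + by rewrite ge_min lexx orbT.
Qed.

Lemma plan_ext_rc C : right_continuous (plan_ext C).
Proof.
move=> t; rewrite /plan_ext.
have [t0|t0] := ltP t 0.
  apply: cvg_near_cst.
  near=> x.
  have -> // : x < 0 by near: x; exact: nbhs_right_lt.
have [tT|tT] := ltP t T.
  have tC : C x @[x --> t^'+] --> C t by apply: plan_rc; rewrite t0.
  apply: cvg_trans tC; apply: near_eq_cvg; near=> x.
  have tx : t < x by near: x; exact: nbhs_right_gt.
  have xT : x < T by near: x; exact: nbhs_right_lt.
  rewrite ltNge (le_trans t0 (ltW tx))/=.
  by rewrite (min_idPl _)// ltW.
apply: cvg_near_cst; near=> x.
have tx : t < x by near: x; exact: nbhs_right_gt.
rewrite ltNge (le_trans t0 (ltW tx))/=.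
by rewrite (min_idPr _)// (le_trans tT)// ltW.
Unshelve. all: by end_near.
Qed.

HB.instance Definition _ C :=
  isCumulative.Build R _ R (plan_ext C) (@plan_ext_nd C) (@plan_ext_rc C).

Definition plan_measure C := lebesgue_stieltjes_measure (plan_ext C).

Definition budget_set (r w : R) : set (plan T_gt0) :=
  [set C | (\int[plan_measure C]_(t in `[0%R, T]) (expR (- r * t)%R)%:E <= w%:E)%E].

Definition satisfaction (y beta : R) C (t : R) : R :=
  y * expR (- beta * t) +
  beta * \int[plan_measure C]_(s in `[0, t]) expR (- beta * (t - s)).

Definition EZ_psi (rho alpha : R) : R := (1 - rho) / (1 - alpha^-1).

Definition EZ_utility (y beta delta rho alpha : R) C (t : R) : R :=
  (1 - rho)^-1 *
  (\int[lebesgue_measure]_(s in `[t, T])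
     (delta * expR (delta * (t - s)) *
      satisfaction y beta C s `^ (1 - alpha^-1))) `^ EZ_psi rho alpha.

Definition optimal (w r y beta delta rho alpha : R) C : Prop :=
  budget_set r w C /\
  (EZ_utility y beta delta rho alpha C 0)%:E =
  ereal_sup [set (EZ_utility y beta delta rho alpha C' 0)%:E
            | C' in budget_set r w].

(* dC = gulp at time 0 + rate(s) ds on ]a, b], on the horizon [0, T]. *)
Definition gulp_then_rate (gulp a b : R) (rate : R -> R) C : Prop :=
  forall t, 0 <= t <= T ->
  C t = gulp + \int[lebesgue_measure]_(s in `]a, b] `&` `[0, t]) rate s.

End PlanMeasure.

Section Constants.
Context (R : realType).
Implicit Types T r beta delta alpha w y K : R.

Definition tau_bar T r beta delta alpha : R :=
  if delta + beta * (1 - alpha^-1) != 0 then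
    T - (delta + beta * (1 - alpha^-1))^-1 *
        ln ((r + beta) / (r + beta / alpha - delta))
  else T - (r + beta)^-1.

Definition k_star T r beta delta alpha : R :=
  let tau := tau_bar T r beta delta alpha in
  if delta != (1 - alpha^-1) * r then
    (r + beta / alpha - delta) / (beta * (delta - (1 - alpha^-1) * r)) *
    (1 - expR (- (alpha * delta + (1 - alpha) * r) * tau))
  else (1 - alpha * (delta - r) / beta) * tau.

(* Both branches express that consuming from the end of the waiting period to
   tau_bar costs exactly w. In the second branch the printed formula
     K^-alpha (ln K / beta + ln y / (alpha beta) - (r + beta/alpha - delta) tau)
       = - alpha w
   misses a factor 1/beta in front of the term in tau and has alpha for
   1/alpha on the right; with it the resulting plan does not cost w. *)
Definition K_equation T r beta delta alpha w y K : Prop :=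
  let tau := tau_bar T r beta delta alpha in
  if delta != (1 - alpha^-1) * r then
    K `^ (- ((r + beta) / (r + beta / alpha - delta))) *
      y `^ (- ((alpha * delta - (alpha - 1) * r) /
               (beta + alpha * (r - delta)))) -
    K `^ (- alpha) * expR (- (alpha * delta - (alpha - 1) * r) * tau) =
    beta * (alpha * delta - (alpha - 1) * r) / (beta + alpha * (r - delta)) * w
  else
    K `^ (- alpha) *
      (beta^-1 * ln K + (alpha * beta)^-1 * ln y -
       beta^-1 * (r + beta / alpha - delta) * tau) =
    - (alpha^-1 * w).

Definition tau_under r beta delta alpha y (M : R) : R :=
  (r + beta / alpha - delta)^-1 *
  ln (M * ((r + beta) / beta) * y `^ alpha^-1).

End Constants.

(* Main.v *)
Require Import Defs.
From HB Require Import structures.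
From mathcomp Require Import all_boot all_order all_algebra.
From mathcomp Require Import all_classical all_reals all_analysis.
From mathcomp Require Import measurable_realfun.
From mathcomp Require Import ring lra.
Set Implicit Arguments.
Unset Strict Implicit.
Unset Printing Implicit Defensive.
Import Order.TTheory GRing.Theory Num.Theory.
Import numFieldNormedType.Exports.
Local Open Scope classical_set_scope.
Local Open Scope ring_scope.

(** The problem is concave, so a feasible plan that satisfies the first-order
    conditions is optimal, and the plans of the statement are built to satisfy
    them.

    Write a = 1 - 1/alpha.  Because rho < 1/alpha, i.e. a < 1 - rho, the utility
    U_0 is an increasing function of the additively separable objective
    (1/a) int_0^T delta e^{-delta s} Y_s^a ds ([powR_normalized_le]), which is
    concave in Y, and Y is affine in C.  Let q_s = delta e^{-delta s} Y_s^{a-1}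
    be the marginal utility along a plan C, and
      phi(v) = int_v^T q_s e^{-beta (s-v)} ds
    its shadow value, the marginal benefit (divided by beta) of one more unit
    consumed at time v.  By concavity and Tonelli, the gain of switching from
    C to C' is at most beta (int phi dC' - int phi dC).  Hence C is optimal as
    soon as phi(v) <= m e^{-rv} on [0,T] for some m >= 0 and int phi dC >= m w,
    since int phi dC' <= m int e^{-rv} dC' <= m w ([shadow_price_optimal]).

    Both cases of the theorem are instances of one family: a gulp g at 0, then
    the rate (alpha kappa/beta) A e^{-lambda t} on ]t0, b], where
    kappa = r + beta/alpha - delta, lambda = alpha (delta - r), and either g = 0
    or t0 = 0.  If y + beta g = A e^{alpha kappa t0}, the level of satisfaction is
      Y_s = A e^{-beta s + alpha kappa cl(s)},   cl(s) = max(t0, min(s, b)),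
    that is, A e^{-lambda s} while consuming and pure decay at rate beta otherwise.
    Then q_s e^{-beta s} is proportional to e^{-theta s - kappa cl(s)} with
    theta + kappa = r + beta, so it is proportional to e^{-(r+beta) s} on [t0, b]
    and, relative to that exponential, smaller before t0 and larger after b.
    Integrating from v to T gives phi(v) <= m e^{-rv} with equality on [t0, b],
    provided that the utility accrued after b equals the shadow price at b; this
    last condition is the definition of tau_bar ([tau_bar_terminal_shadow]).

    It remains to exhaust the wealth.  Starting at t0 = 0, the budget equation
    determines the gulp, which is nonnegative when w >= k* y.  Otherwise there is
    no gulp and the starting date a has to satisfy W(a) = w, where the cost W(a)
    of the plan that waits until a is continuous, decreases strictly while
    positive, equals k* y at a = 0 and vanishes at a = tau_bar.  The unknown K of
    the statement is a reparametrization of a, by K = y^{-1/alpha} e^{kappa a},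
    under which the equation for K becomes W(a) = w ([K_equationP]). *)

(** * Primitives of exponentials *)

Section ExpPrimitive.
Context {R : realType}.
Implicit Types c s t x : R.

(** The case split removes the singularity at c = 0; it is the origin of the case
    splits in the constants tau_bar and k* and in the equation for K. *)
Definition exp_primitive c t : R := if c == 0 then t else (1 - expR (- c * t)) / c.

Lemma exp_primitive0 c : exp_primitive c 0 = 0.
Proof. by rewrite /exp_primitive; case: ifP => // _; rewrite mulr0 expR0 subrr mul0r. Qed.

Lemma exp_primitiveE c t : c != 0 -> exp_primitive c t = (1 - expR (- c * t)) / c.
Proof. by rewrite /exp_primitive => /negbTE ->. Qed.

Lemma is_derive_exp_primitive c t :
  is_derive t (1 : R) (exp_primitive c) (expR (- c * t)).
Proof.
rewrite /exp_primitive; have [->|c0] := eqVneq c 0.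
  by rewrite oppr0 mul0r expR0; exact: is_derive_id.
apply: is_derive_eq.
rewrite /GRing.scale /=.
by field.
Qed.

Lemma continuous_expRM c : continuous (fun x => expR (- c * x)).
Proof.
move=> x; apply: continuous_comp; last exact: continuous_expR.
by apply: continuousM; [exact: cst_continuous|exact: cvg_id].
Qed.

Lemma measurable_expRM c (D : set R) : measurable_fun D (fun x => expR (- c * x)).
Proof.
apply: measurable_funTS; apply: continuous_measurable_fun.
exact: continuous_expRM.
Qed.

Lemma continuous_exp_primitive c : continuous (exp_primitive c).
Proof.
move=> t; apply/differentiable_continuous/derivable1_diffP.
by have [] := is_derive_exp_primitive c t.
Qed.

Lemma integral_exp c s t : s <= t ->
  (\int[lebesgue_measure]_(x in `]s, t]) (expR (- c * x))%:E =
   (exp_primitive c t - exp_primitive c s)%:E)%E.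
Proof.
rewrite le_eqVlt => /predU1P[->|st].
  by rewrite set_itvoc0 integral_set0 subrr.
rewrite integral_itv_obnd_cbnd; last first.
  by apply/measurable_EFinP; exact: measurable_expRM.
rewrite (@continuous_FTC2 _ _ (exp_primitive c)) ?EFinB//.
- by apply: continuous_subspaceT; exact: continuous_expRM.
- split.
  + by move=> z _; have [] := is_derive_exp_primitive c z.
  + exact/cvg_at_right_filter/continuous_exp_primitive.
  + exact/cvg_at_left_filter/continuous_exp_primitive.
- by move=> z _; rewrite derive1E; apply: derive_val; exact: is_derive_exp_primitive.
Qed.

Lemma exp_primitive_lt c s t : s < t -> exp_primitive c s < exp_primitive c t.
Proof.
move=> st; rewrite /exp_primitive; case: (ltrgt0P c) => c0.
- rewrite ltr_pM2r ?invr_gt0// ltrD2l ltrN2 ltr_expR; nra.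
- rewrite ltr_nM2r ?invr_lt0// ltrD2l ltrN2 ltr_expR; nra.
- by [].
Qed.

Lemma exp_primitive_le c s t : s <= t -> exp_primitive c s <= exp_primitive c t.
Proof. by rewrite le_eqVlt => /predU1P[->//|/exp_primitive_lt/ltW]. Qed.

End ExpPrimitive.

(** * Measures with a density *)

Section Density.
Context d (T : measurableType d) (R : realType).
Variables (mu : {measure set T -> \bar R}) (f : T -> R).
Hypotheses (mf : measurable_fun setT f) (f0 : forall x, 0 <= f x).
Local Open Scope ereal_scope.

(** The measure f mu.  It will describe the absolutely continuous part of a
    consumption plan. *)
Definition density of measurable_fun setT f & (forall x, (0 <= f x)%R) :=
  fun A : set T => \int[mu]_(x in A) (f x)%:E.

Local Notation nu := (density mf f0).

Let nu0 : nu set0 = 0. Proof. by rewrite /density integral_set0. Qed.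

Let nu_ge0 A : 0 <= nu A.
Proof. by apply: integral_ge0 => x _; rewrite lee_fin. Qed.

Let nu_sigma_additive : semi_sigma_additive nu.
Proof.
apply: semi_sigma_additive_nng_induced; first exact/measurable_EFinP.
by move=> x; rewrite lee_fin.
Qed.

HB.instance Definition _ := isMeasure.Build _ _ _ nu nu0 nu_ge0 nu_sigma_additive.

Import HBNNSimple.

Let integral_density_nnsfun (h : {nnsfun T >-> R}) :
  \int[nu]_x (h x)%:E = \int[mu]_x ((h x)%:E * (f x)%:E).
Proof.
rewrite integralT_nnsfun sintegralE.
transitivity (\int[mu]_x (\sum_(y \in range h)
    (y * \1_(h @^-1` [set y]) x)%:E * (f x)%:E)).
  rewrite ge0_integral_fsum//; last 2 first.
    - move=> y; apply: emeasurable_funM; last exact/measurable_EFinP.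
      by apply/measurable_EFinP; apply: measurable_funM.
    - by move=> y x _; rewrite mule_ge0 ?nnfun_muleindic_ge0// lee_fin.
  apply: eq_fsbigr => r /[!inE] -[t _ <-].
  under eq_integral do rewrite EFinM -muleA.
  rewrite ge0_integralZl//; last 3 first.
  - apply: emeasurable_funM; last exact/measurable_EFinP.
    exact/measurable_EFinP.
  - by move=> x _; rewrite mule_ge0 ?lee_fin.
  - by rewrite lee_fin.
  congr (_ * _); rewrite [LHS]integral_mkcond; apply: eq_integral => x _.
  by rewrite epatch_indic muleC.
apply: eq_integral => x _.
rewrite -ge0_mule_fsuml => [|y]; last exact: nnfun_muleindic_ge0.
by rewrite fsumEFin // -(fimfunE _ x).
Qed.

Lemma ge0_integral_density (g : T -> R) (D : set T) : measurable D ->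
  measurable_fun D g -> (forall x, D x -> (0 <= g x)%R) ->
  \int[nu]_(x in D) (g x)%:E = \int[mu]_(x in D) (g x * f x)%:E.
Proof.
move=> mD mg g0; rewrite [LHS](integral_mkcond D) [RHS](integral_mkcond D).
pose G := (EFin \o g) \_ D.
have mG : measurable_fun setT G.
  by apply/(measurable_restrictT _ _).1 => //; exact/measurable_EFinP.
have G0 x : 0 <= G x.
  by rewrite /G patchE; case: ifPn => // /[!inE] /g0; rewrite lee_fin.
transitivity (\int[mu]_x (G x * (f x)%:E)); last first.
  apply: eq_integral => x _; rewrite /G !patchE.
  by case: ifPn => _ //; rewrite mul0e.
pose h := nnsfun_approx measurableT mG.
have hG x : (h n x)%:E @[n --> \oo] --> G x by exact: cvg_nnsfun_approx.
transitivity (limn (fun n => \int[nu]_x (h n x)%:E)).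
  rewrite -monotone_convergence//.
  - by apply: eq_integral => x _; apply/esym/cvg_lim => //; exact: hG.
  - by move=> n; exact/measurable_EFinP.
  - by move=> n x _; rewrite lee_fin.
  - by move=> x _ a b ab; rewrite lee_fin; exact/lefP/nd_nnsfun_approx.
under eq_fun do rewrite integral_density_nnsfun.
rewrite -monotone_convergence//.
- by apply: eq_integral => x _; apply/cvg_lim => //; apply: cvgeZr => //; exact: hG.
- by move=> n; apply: emeasurable_funM; exact/measurable_EFinP.
- by move=> n x _; rewrite mule_ge0// lee_fin.
- by move=> x _ a b ab; rewrite lee_wpmul2r ?lee_fin//; exact/lefP/nd_nnsfun_approx.
Qed.

End Density.

(** * Integration against a consumption plan *)

Section PlanIntegrals.
Context {R : realType} {T : R} {T_gt0 : 0 < T}.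
Implicit Types (C : plan T_gt0) (q : R -> R) (beta s t v : R).

Lemma lebesgue_stieltjes_itvoc (f : cumulative R R) s t : s <= t ->
  lebesgue_stieltjes_measure f `]s, t] = (f t - f s)%:E.
Proof.
move=> st; rewrite /lebesgue_stieltjes_measure /measure_extension.
by rewrite measurable_mu_extE/=; [exact: wlength_itv_bnd|exact: is_ocitv].
Qed.

(** A crude bound, whose purpose is that all integrals against a plan over the
    horizon are finite. *)
Lemma plan_measure_le C t : 0 <= t <= T -> (plan_measure C `[0%R, t] <= (C T)%:E)%E.
Proof.
move=> /andP[t0 tT].
have -> : C T = plan_ext C T - plan_ext C (- 1).
  by rewrite /plan_ext ltNge (ltW T_gt0)/= minxx ltrN10 subr0.
rewrite -lebesgue_stieltjes_itvoc; last by rewrite (le_trans _ (ltW T_gt0)).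
apply: le_measure; rewrite ?inE//=.
by apply: subset_itv; rewrite bnd_simp.
Qed.

(** The part of the level of satisfaction that is due to consumption, up to the
    factor beta, so that Y is affine in it.  It is extended-real valued in order
    to be handled by Tonelli's theorem. *)
Definition discounted_consumption beta C s : \bar R :=
  (\int[plan_measure C]_(v in `[0%R, s]) (expR (- beta * (s - v)))%:E)%E.

Lemma measurable_discount beta s (D : set R) :
  measurable_fun D (fun v => expR (- beta * (s - v))).
Proof.
apply: measurable_funTS; apply: measurableT_comp => //.
by apply: measurable_funM => //; apply: measurable_funB.
Qed.

Lemma discounted_consumption_ge0 beta C s : (0 <= discounted_consumption beta C s)%E.
Proof. by apply: integral_ge0 => v _; rewrite lee_fin expR_ge0. Qed.

Lemma discounted_consumption_le beta C s : 0 <= beta -> 0 <= s <= T ->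
  (discounted_consumption beta C s <= (C T)%:E)%E.
Proof.
move=> b0 sT; apply: (le_trans _ (plan_measure_le C sT)).
rewrite /discounted_consumption -[leRHS]mul1e -integral_cst//.
apply: ge0_le_integral => //.
- by apply/measurable_EFinP; exact: measurable_discount.
- move=> v /=; rewrite in_itv/= => /andP[v0 vs].
  by rewrite lee_fin -expR0 ler_expR mulNr oppr_le0 mulr_ge0// subr_ge0.
Qed.

Lemma satisfactionE y beta C s : satisfaction y beta C s =
  y * expR (- beta * s) + beta * fine (discounted_consumption beta C s).
Proof. by []. Qed.

(** Extended by 0 outside the triangle 0 <= v <= s, so that both iterated
    integrals range over the whole line. *)
Let kern beta q (p : R * R) : \bar R :=
  if (0 <= p.2) && (p.2 <= p.1) then
    (q p.1 * expR (- beta * (p.1 - p.2)))%:E else 0%E.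

Let measurable_kern beta q : measurable_fun setT q ->
  measurable_fun setT (kern beta q).
Proof.
move=> mq; apply: measurable_fun_ifT.
- by apply: measurable_and; apply: measurable_fun_ler.
- apply/measurable_EFinP; apply: measurable_funM.
    exact: measurableT_comp.
  apply: measurableT_comp => //; apply: measurable_funM => //.
  exact: measurable_funB.
- by [].
Qed.

Let kern_ge0 beta q p : (forall s, 0 <= q s) -> (0 <= kern beta q p)%E.
Proof.
by move=> q0; rewrite /kern; case: ifP => // _; rewrite lee_fin mulr_ge0 ?expR_ge0.
Qed.

Let integral_kern C beta q s : 0 <= q s ->
  (\int[plan_measure C]_v kern beta q (s, v) =
   (q s)%:E * discounted_consumption beta C s)%E.
Proof.
move=> q0; rewrite /discounted_consumption -ge0_integralZl//.
- rewrite [RHS]integral_mkcond; apply: eq_integral => v _.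
  by rewrite /kern patchE/= mem_setE in_itv/= EFinM.
- by apply/measurable_EFinP; exact: measurable_discount.
Qed.

Lemma measurable_discounted_consumption beta C :
  measurable_fun setT (discounted_consumption beta C).
Proof.
rewrite (_ : discounted_consumption beta C =
  fun s => \int[plan_measure C]_v kern beta (cst 1%R) (s, v))%E; last first.
  by apply/funext => s; rewrite integral_kern// mul1e.
apply: (@measurable_fun_fubini_tonelli_F _ _ _ _ _
  [the {sigma_finite_measure set _ -> \bar R} of plan_measure C] (kern beta (cst 1%R))).
- exact: measurable_kern.
- by move=> p; exact: kern_ge0.
Qed.

(** With q the marginal utility of satisfaction along a plan, this is the marginal
    benefit, up to the factor beta, of one more unit consumed at time v. *)
Definition shadow_value beta q v : \bar R :=
  (\int[lebesgue_measure]_(s in `[v, T]) (q s * expR (- beta * (s - v)))%:E)%E.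

Let trunc q s := if (s <= T) then q s else 0.

Let measurable_trunc q : measurable_fun setT q -> measurable_fun setT (trunc q).
Proof. by move=> mq; apply: measurable_fun_ifT => //; apply: measurable_fun_ler. Qed.

Let trunc_ge0 q s : (forall s, 0 <= q s) -> 0 <= trunc q s.
Proof. by move=> q0; rewrite /trunc; case: ifP. Qed.

Let shadow_valueE beta q v : 0 <= v ->
  (\int[lebesgue_measure]_s kern beta (trunc q) (s, v) = shadow_value beta q v)%E.
Proof.
move=> v0; rewrite [RHS]integral_mkcond; apply: eq_integral => s _.
rewrite /kern/= patchE mem_setE in_itv/= v0/= /trunc.
by case: (v <= s) => //=; case: (s <= T) => //; rewrite mul0r.
Qed.

Lemma shadow_value_ge0 beta q v : (forall s, 0 <= q s) -> (0 <= shadow_value beta q v)%E.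
Proof.
by move=> q0; apply: integral_ge0 => s _; rewrite lee_fin mulr_ge0// expR_ge0.
Qed.

Lemma measurable_shadow_value beta q :
  measurable_fun setT q -> (forall s, 0 <= q s) ->
  measurable_fun `[0%R, T] (shadow_value beta q).
Proof.
move=> mq q0.
apply: (@eq_measurable_fun _ _ _ _ _
  (fun v => \int[lebesgue_measure]_s kern beta (trunc q) (s, v))%E).
  by move=> v; rewrite inE/= in_itv/= => /andP[v0 _]; exact: shadow_valueE.
apply: measurable_funTS.
apply: (@measurable_fun_fubini_tonelli_G _ _ _ _ _ lebesgue_measure
  (kern beta (trunc q))).
- by apply: measurable_kern; exact: measurable_trunc.
- by move=> p; apply: kern_ge0 => s; exact: trunc_ge0.
Qed.

(** Tonelli's theorem: a consumption plan can be valued by its effect on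
    satisfaction at each later date, or by the shadow values at the dates of
    consumption. *)
Lemma integral_discounted_consumption C beta q :
  measurable_fun setT q -> (forall s, 0 <= q s) ->
  (\int[lebesgue_measure]_(s in `[0%R, T]) ((q s)%:E * discounted_consumption beta C s) =
   \int[plan_measure C]_(v in `[0%R, T]) shadow_value beta q v)%E.
Proof.
move=> mq q0.
transitivity (\int[lebesgue_measure]_s
    \int[plan_measure C]_v kern beta (trunc q) (s, v))%E.
  rewrite integral_mkcond; apply: eq_integral => s _.
  rewrite integral_kern; last exact: trunc_ge0.
  rewrite patchE mem_setE in_itv/= /trunc.
  case: ifPn => [/andP[_ ->]//|]; rewrite negb_and => /orP[s0|/negbTE ->].
  - by rewrite /discounted_consumption set_itv_ge ?integral_set0 ?mule0.
  - by rewrite mul0e.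
rewrite (@fubini_tonelli _ _ _ _ _ lebesgue_measure
  [the {sigma_finite_measure set _ -> \bar R} of plan_measure C])//; last 2 first.
- by apply: measurable_kern; exact: measurable_trunc.
- by move=> p; apply: kern_ge0 => s; exact: trunc_ge0.
rewrite [RHS]integral_mkcond; apply: eq_integral => v _.
rewrite patchE mem_setE in_itv/=.
case: ifPn => [/andP[v0 vT]|v0T]; first exact: shadow_valueE.
apply: integral0_eq => s _; rewrite /kern/= /trunc.
case: ifPn => // /andP[v0 vs]; case: ifPn => sT; last by rewrite mul0r.
by move: v0T; rewrite v0 (le_trans vs sT).
Qed.

End PlanIntegrals.

(** * Sufficiency of the first-order conditions *)

Section Verification.
Context {R : realType}.
Implicit Types a x z : R.

(** Concavity of the power utility z^a / a, by its tangent at x.  After scaling to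
    x = 1, both signs of a follow from the tangent inequality 1 + u <= e^u. *)
Lemma powR_le_tangent a x z : a != 0 -> a < 1 -> 0 < x -> 0 < z ->
  z `^ a / a <= x `^ a / a + x `^ (a - 1) * (z - x).
Proof.
move=> a0 a1 x0 z0.
have xa0 : 0 < x `^ a by exact: powR_gt0.
pose t := z / x.
have t0 : 0 < t by rewrite divr_gt0.
have zE : z = x * t by rewrite /t mulrC divfK ?gt_eqF.
have xa1 : x `^ (a - 1) = x `^ a / x by rewrite powRD ?powR_inv1 ?(ltW x0) ?(gt_eqF x0) ?implybT.
rewrite zE powRM ?(ltW x0) ?(ltW t0)// xa1.
have -> : x `^ a / a + x `^ a / x * (x * t - x) = x `^ a * (a^-1 + (t - 1)).
  by field; rewrite a0 gt_eqF.
rewrite -mulrA ler_pM2l//.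
set m := a * ln t.
have taE : t `^ a = expR m by rewrite /powR gt_eqF.
have em0 : 0 < expR m := expR_gt0 m.
(* Tangents of exp at m = a ln t, evaluated at ln t and at 0; averaging them with
   weights a and 1 - a gives the inequality when a is positive. *)
have h1 : expR m * (1 + (ln t - m)) <= t.
  rewrite -[leRHS]lnK ?posrE// -[X in _ <= expR X](subrKC m) expRD.
  by rewrite ler_pM2l// expR_ge1Dx.
have h2 : expR m * (1 - m) <= 1.
  rewrite -[leRHS]expR0 -[X in _ <= expR X](subrr m) expRD ler_pM2l//.
  exact: expR_ge1Dx.
rewrite taE; have [aneg|apos] : a < 0 \/ 0 < a by apply/orP; rewrite -neq_lt.
- have h3 : ln t <= t - 1.
    have := expR_ge1Dx (ln t); rewrite lnK ?posrE//; lra.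
  have h4 := expR_ge1Dx m.
  have h5 : 1 + a * (t - 1) <= expR m by apply: le_trans h4; rewrite /m; nra.
  rewrite -(ler_nM2l aneg) mulrDr divff// mulrCA divff// mulr1; lra.
- rewrite -(ler_pM2l apos) mulrDr divff// mulrCA divff// mulr1.
  have mE : m = a * ln t by [].
  nra.
Qed.

(** This is where rho < 1/alpha enters, with q = 1 - rho: since a < q, the outer
    power q/a and the outer factor 1/q reverse the order together or not at all,
    whatever the signs of a and q. *)
Lemma powR_normalized_le a (q i i' : R) : a != 0 -> q != 0 -> a < q ->
  0 < i -> 0 < i' -> i' / a <= i / a ->
  q^-1 * i' `^ (q / a) <= q^-1 * i `^ (q / a).
Proof.
move=> a0 q0 aq I0 I0'.
have powP x z p : 0 <= p -> 0 < x -> 0 < z -> x <= z -> x `^ p <= z `^ p.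
  by move=> p0 x0 z0 xz; apply: ge0_ler_powR; rewrite ?nnegrE// ltW.
have powN x z p : p <= 0 -> 0 < x -> 0 < z -> x <= z -> z `^ p <= x `^ p.
  by move=> p0 x0 z0 xz; rewrite /powR !gt_eqF// ler_expR ler_wnM2l// ler_ln.
have [aneg|apos] : a < 0 \/ 0 < a by apply/orP; rewrite -neq_lt.
- rewrite ler_nM2r ?invr_lt0// => ii'.
  have [qneg|qpos] : q < 0 \/ 0 < q by apply/orP; rewrite -neq_lt.
  + rewrite ler_nM2l ?invr_lt0//; apply: powP => //.
    by rewrite ltW// nmulr_rgt0 ?invr_lt0.
  + rewrite ler_pM2l ?invr_gt0//; apply: powN => //.
    by rewrite ltW// pmulr_rlt0 ?invr_lt0.
- rewrite ler_pM2r ?invr_gt0// => ii'.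
  have qpos : 0 < q := lt_trans apos aq.
  rewrite ler_pM2l ?invr_gt0//; apply: powP => //.
  by rewrite ltW// mulr_gt0 ?invr_gt0.
Qed.

Lemma bounded_integrable (T M : R) (f : R -> R) :
  measurable_fun setT f -> (forall s, 0 <= s <= T -> `|f s| <= M) ->
  lebesgue_measure.-integrable `[0%R, T] (EFin \o f).
Proof.
move=> mf fM; apply: measurable_bounded_integrable => //.
- by rewrite /= lebesgue_measure_itv/=; case: ifP => // _; rewrite -EFinB ltry.
- exact: measurable_funTS.
- exists M; split; first exact: num_real.
  move=> N MN s /=; rewrite in_itv/= => sT.
  by rewrite (le_trans (fM s sT))// ltW.
Qed.

Context {T : R} {T_gt0 : 0 < T}.
Variables (w r y beta delta rho alpha : R).
Hypotheses (y_gt0 : 0 < y) (beta_gt0 : 0 < beta) (delta_gt0 : 0 < delta).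
Implicit Types C : plan T_gt0.

Local Notation Y := (satisfaction y beta).
Local Notation X := (discounted_consumption beta).

Lemma satisfaction_ge C s : 0 <= s -> y * expR (- beta * s) <= Y C s.
Proof.
move=> s0; rewrite satisfactionE lerDl mulr_ge0 ?(ltW beta_gt0)//.
exact/fine_ge0/discounted_consumption_ge0.
Qed.

Lemma satisfaction_gt0 C s : 0 <= s -> 0 < Y C s.
Proof. by move=> /(satisfaction_ge C); apply: lt_le_trans; rewrite mulr_gt0// expR_gt0. Qed.

(** Satisfaction stays in a compact part of ]0, +oo[, where negative powers are
    bounded too. *)
Lemma satisfaction_bounds C s : 0 <= s <= T ->
  y * expR (- beta * T) <= Y C s <= y + beta * C T.
Proof.
move=> sT; have /andP[s0 sT'] := sT; apply/andP; split.
  apply: le_trans (satisfaction_ge C s0); rewrite ler_pM2l// ler_expR.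
  by rewrite !mulNr lerN2 ler_pM2l.
rewrite satisfactionE lerD//.
  rewrite ler_piMr ?(ltW y_gt0)// -expR0 ler_expR mulNr oppr_le0.
  by rewrite mulr_ge0// ltW.
rewrite ler_pM2l//; have := discounted_consumption_le C (ltW beta_gt0) sT.
by have := discounted_consumption_ge0 beta C s; case: (X C s).
Qed.

Lemma discounted_consumption_fin_num C s : 0 <= s <= T -> X C s \is a fin_num.
Proof.
move=> sT; rewrite ge0_fin_numE ?discounted_consumption_ge0//.
by rewrite (le_lt_trans (discounted_consumption_le C (ltW beta_gt0) sT)) ?ltry.
Qed.

Lemma measurable_satisfaction C : measurable_fun setT (Y C).
Proof.
rewrite (_ : Y C = fun s => y * expR (- beta * s) + beta * fine (X C s))//.
apply: measurable_funD; apply: measurable_funM => //.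
  exact: measurable_expRM.
apply: (measurableT_comp (f := fine)).
  exact: fine_measurable.
exact: measurable_discounted_consumption.
Qed.

Local Notation a := (1 - alpha^-1).

Definition flow_utility C s := delta * expR (delta * (0 - s)) * Y C s `^ a.

Definition marginal_utility C s := delta * expR (delta * (0 - s)) * Y C s `^ (a - 1).

Local Notation I C := (\int[lebesgue_measure]_(s in `[0, T]) flow_utility C s).

Let measurable_weight_powR C (p : R) :
  measurable_fun setT (fun s : R => delta * expR (delta * (0 - s)) * Y C s `^ p).
Proof.
apply: measurable_funM.
  apply: measurable_funM => //; apply: measurableT_comp => //.
  by apply: measurable_funM => //; apply: measurable_funB.
apply: (measurableT_comp (measurable_powR p)); exact: measurable_satisfaction.
Qed.

Let weight_powR_bounds C (p : R) : exists lo hi : R, 0 < lo /\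
  forall s : R, 0 <= s <= T ->
    lo <= delta * expR (delta * (0 - s)) * Y C s `^ p <= hi.
Proof.
have T0 : (0 : R) <= 0 <= T by rewrite lexx ltW.
pose lo := y * expR (- beta * T); pose hi := y + beta * C T.
have lo0 : 0 < lo by rewrite mulr_gt0 ?expR_gt0.
have hi0 : 0 < hi.
  by have /andP[h1 h2] := satisfaction_bounds C T0; rewrite (lt_le_trans lo0)// (le_trans h1).
exists (delta * expR (delta * (0 - T)) * Num.min (lo `^ p) (hi `^ p)).
exists (delta * Num.max (lo `^ p) (hi `^ p)); split.
  by rewrite !mulr_gt0 ?expR_gt0// lt_min !powR_gt0.
move=> s sT; have /andP[lY Yh] := satisfaction_bounds C sT.
have Y0 : 0 < Y C s := lt_le_trans lo0 lY.
have /andP[s0 sT'] := sT.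
have pw : Num.min (lo `^ p) (hi `^ p) <= Y C s `^ p <= Num.max (lo `^ p) (hi `^ p).
  rewrite ge_min le_max; have [p0|p0] := leP 0 p.
    have h1 : lo `^ p <= Y C s `^ p by apply: ge0_ler_powR; rewrite ?nnegrE// ltW.
    have h2 : Y C s `^ p <= hi `^ p by apply: ge0_ler_powR; rewrite ?nnegrE// ltW.
    by rewrite h1 h2 orbT.
  have powN x z : 0 < x -> 0 < z -> x <= z -> z `^ p <= x `^ p.
    by move=> x0 z0 xz; rewrite /powR !gt_eqF// ler_expR ler_nM2l// ler_ln.
  by rewrite (powN _ hi)// (powN lo _)// orbT.
have /andP[pw1 pw2] := pw.
have e1 : expR (delta * (0 - T)) <= expR (delta * (0 - s)).
  by rewrite ler_expR ler_pM2l// lerD2l lerN2.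
have e2 : expR (delta * (0 - s)) <= 1.
  by rewrite -expR0 ler_expR sub0r mulrN oppr_le0 mulr_ge0// ltW.
apply/andP; split.
  by rewrite -!mulrA ler_pM2l// ler_pM ?expR_ge0// le_min !powR_ge0.
by rewrite -mulrA ler_pM2l// -[leRHS]mul1r ler_pM ?expR_ge0 ?powR_ge0.
Qed.

Lemma integrable_flow_utility C :
  lebesgue_measure.-integrable `[0%R, T] (EFin \o flow_utility C).
Proof.
have [lo [hi [lo0 b]]] := weight_powR_bounds C a.
apply: (@bounded_integrable _ hi); first exact: measurable_weight_powR.
by move=> s /b /andP[h1 h2]; rewrite ger0_norm// (le_trans (ltW lo0)).
Qed.

Lemma total_flow_utility_gt0 C : 0 < I C.
Proof.
have [lo [hi [lo0 b]]] := weight_powR_bounds C a.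
apply: (@lt_le_trans _ _ (lo * T)); first by rewrite mulr_gt0.
have -> : lo * T = \int[lebesgue_measure]_(s in `[0%R, T]) (cst lo s).
  by rewrite Rintegral_cst//= lebesgue_measure_itv/= lte_fin T_gt0/= oppr0 addr0.
apply: le_Rintegral => //.
- apply: (@bounded_integrable _ lo) => // s _ /=; by rewrite ger0_norm// ltW.
- exact: integrable_flow_utility.
- by move=> s /=; rewrite in_itv/= => /b /andP[].
Qed.

Lemma measurable_marginal_utility C : measurable_fun setT (marginal_utility C).
Proof. exact: measurable_weight_powR. Qed.

Lemma marginal_utility_ge0 C s : 0 <= marginal_utility C s.
Proof. by rewrite !mulr_ge0 ?expR_ge0 ?powR_ge0// ltW. Qed.

Hypotheses (a_neq0 : a != 0) (a_lt1 : a < 1).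

Local Notation value C C' :=
  (\int[lebesgue_measure]_(s in `[0%R, T])
     ((marginal_utility C s)%:E * X C' s))%E.

Let satisfactionB C C' s :
  Y C' s - Y C s = beta * (fine (X C' s) - fine (X C s)).
Proof. by rewrite !satisfactionE opprD addrACA subrr add0r mulrBr. Qed.

Let weighted_tangent (k W u u' p x x' : R) :
  W * (u' / k) <= W * (u / k + p * (beta * (x' - x))) ->
  k^-1 * (W * u') <= k^-1 * (W * u) + beta * (W * p * x' + - 1 * (W * p * x)).
Proof.
move=> h; apply: le_trans (le_trans _ h) _; rewrite le_eqVlt; apply/orP; left;
  apply/eqP; ring.
Qed.

Let EFin_le (u v : \bar R) (p q : R) : u = p%:E -> v = q%:E -> (u <= v)%E -> p <= q.
Proof. by move=> -> ->; rewrite lee_fin. Qed.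

Let le_of_parts (k i i' j j' jx jd l l' l'' m : R) :
  j' = k * i' -> j = k * i -> m = j + jx -> jx = beta * jd -> jd = l' + l'' ->
  l'' = - 1 * l -> j' <= m -> l' <= l -> i' * k <= i * k.
Proof.
move=> -> -> -> -> -> ->; rewrite ![_ * k]mulrC => h ll'.
by apply: (le_trans h); rewrite -[leRHS]addr0 lerD2l mulN1r pmulr_rle0// subr_le0.
Qed.

(** Integrate the tangent inequality at Y along C; what remains of the difference
    Y' - Y is beta times the difference of the consumption parts, since the decay
    of the initial level cancels. *)
Lemma total_flow_utility_le C C' : (value C C' <= value C C)%E ->
  I C' / a <= I C / a.
Proof.
move=> CC'.
pose q := marginal_utility C; pose x (D : plan T_gt0) s := fine (X D s).
have mx D : measurable_fun setT (x D).
  apply: (measurableT_comp (f := fine)); first exact: fine_measurable.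
  exact: measurable_discounted_consumption.
have iq D : lebesgue_measure.-integrable `[0%R, T] (EFin \o (fun s => q s * x D s)).
  have [lo [hi [lo0 b]]] := weight_powR_bounds C (a - 1).
  apply: (@bounded_integrable _ (hi * D T)).
    by apply: measurable_funM; [exact: measurable_marginal_utility|exact: mx].
  move=> s sT; have /andP[h1 h2] := b s sT.
  rewrite normrM ler_pM//.
    by rewrite ger0_norm// marginal_utility_ge0.
  have := discounted_consumption_le D (ltW beta_gt0) sT.
  rewrite /x; have := discounted_consumption_ge0 beta D s.
  by case: (X D s) => [u| |]//=; rewrite !lee_fin => u0; rewrite ger0_norm.
have qE D : value C D = (\int[lebesgue_measure]_(s in `[0%R, T]) (q s * x D s))%:E.
  transitivity (\int[lebesgue_measure]_(s in `[0%R, T]) (q s * x D s)%:E)%E; last first.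
    by apply/esym/fineK/integrable_fin_num => //; exact: iq.
  apply: eq_integral => s; rewrite inE/= in_itv/= => sT.
  by rewrite /x [RHS]EFinM fineK// discounted_consumption_fin_num.
have {CC' qE} CC' : \int[lebesgue_measure]_(s in `[0, T]) (q s * x C' s) <=
    \int[lebesgue_measure]_(s in `[0, T]) (q s * x C s).
  exact: (EFin_le (qE C') (qE C) CC').
have iZ k (f : R -> R) : lebesgue_measure.-integrable `[0%R, T] (EFin \o f) ->
    lebesgue_measure.-integrable `[0%R, T] (EFin \o (fun s => k * f s)).
  by move=> intf; apply: (integrableZl _ k intf).
have iD (f g : R -> R) : lebesgue_measure.-integrable `[0%R, T] (EFin \o f) ->
    lebesgue_measure.-integrable `[0%R, T] (EFin \o g) ->
    lebesgue_measure.-integrable `[0%R, T] (EFin \o (fun s => f s + g s)).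
  by move=> intf intg; apply: (integrableD _ intf intg).
have iI D := iZ a^-1 _ (integrable_flow_utility D).
have iG : lebesgue_measure.-integrable `[0%R, T]
    (EFin \o (fun s => beta * (q s * x C' s + - 1 * (q s * x C s)))).
  exact/iZ/iD/iZ/iq/iq.
have h : \int[lebesgue_measure]_(s in `[0, T]) (a^-1 * flow_utility C' s) <=
   \int[lebesgue_measure]_(s in `[0, T])
     (a^-1 * flow_utility C s + beta * (q s * x C' s + - 1 * (q s * x C s))).
  apply: le_Rintegral => //.
    exact: (iD _ _ (iI C) iG).
  move=> s /=; rewrite in_itv/= => /andP[s0 sT].
  have := powR_le_tangent a_neq0 a_lt1 (satisfaction_gt0 C s0) (satisfaction_gt0 C' s0).
  have W0 : 0 < delta * expR (delta * (0 - s)) by rewrite mulr_gt0 ?expR_gt0.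
  rewrite -(ler_pM2l W0).
  rewrite satisfactionB.
  exact: weighted_tangent.
pose D := `[0%R, T]%classic : set (measurableTypeR R).
have mD : measurable D by exact: measurable_itv.
have e1 := @RintegralZl _ _ _ lebesgue_measure D _ a^-1 mD (integrable_flow_utility C').
have e2 := @RintegralZl _ _ _ lebesgue_measure D _ a^-1 mD (integrable_flow_utility C).
have e3 := @RintegralD _ _ _ lebesgue_measure D _ _ mD (iI C) iG.
have e4 := @RintegralZl _ _ _ lebesgue_measure D _ beta mD
  (iD _ _ (iq C') (iZ (-1) _ (iq C))).
have e5 := @RintegralD _ _ _ lebesgue_measure D _ _ mD (iq C') (iZ (-1) _ (iq C)).
have e6 := @RintegralZl _ _ _ lebesgue_measure D _ (-1) mD (iq C).
exact: (le_of_parts e1 e2 e3 e4 e5 e6 h CC').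
Qed.

Lemma EZ_utility_le C C' : rho != 1 -> rho < alpha^-1 -> I C' / a <= I C / a ->
  EZ_utility y beta delta rho alpha C' 0 <= EZ_utility y beta delta rho alpha C 0.
Proof.
move=> rho1 rho_lt IC.
have q0 : 1 - rho != 0 by rewrite subr_eq0 eq_sym.
have aq : a < 1 - rho by rewrite ltrD2l ltrN2.
have h := powR_normalized_le a_neq0 q0 aq (total_flow_utility_gt0 C)
  (total_flow_utility_gt0 C') IC.
exact: h.
Qed.

(** The first-order conditions are sufficient.  The last hypothesis condenses
    complementary slackness and the exhaustion of wealth: if shadow values equal
    m e^{-rv} for dC-almost every v and C costs w, it holds with equality. *)
Theorem shadow_price_optimal C (m : R) : rho != 1 -> rho < alpha^-1 -> 0 <= m ->
  budget_set r w C ->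
  (forall v, 0 <= v <= T ->
    (shadow_value (T := T) beta (marginal_utility C) v <= (m * expR (- r * v))%:E)%E) ->
  ((m * w)%:E <=
    \int[plan_measure C]_(v in `[0%R, T]) shadow_value (T := T) beta (marginal_utility C) v)%E ->
  optimal w r y beta delta rho alpha C.
Proof.
move=> rho1 rho_lt m0 Cw le_price ge_mw; split=> //.
apply/eqP; rewrite eq_le; apply/andP; split.
  by apply: ereal_sup_ubound; exists C.
apply: ge_ereal_sup => _ [C' C'w <-]; rewrite lee_fin.
apply: (EZ_utility_le rho1 rho_lt); apply: total_flow_utility_le.
have mq := measurable_marginal_utility C; have q0 := marginal_utility_ge0 C.
apply: (@le_trans _ _ (m * w)%:E); last first.
  by rewrite (integral_discounted_consumption C beta mq q0).
rewrite (integral_discounted_consumption C' beta mq q0).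
have mp : measurable_fun `[0%R, T] (fun v => (expR (- r * v))%:E).
  by apply/measurable_EFinP; exact: measurable_expRM.
apply: (@le_trans _ _ (\int[plan_measure C']_(v in `[0%R, T]) (m%:E * (expR (- r * v))%:E))%E).
  apply: ge0_le_integral.
  - exact: measurable_itv.
  - by move=> v _; exact: shadow_value_ge0.
  - exact: measurable_shadow_value.
  - exact: measurable_funeM.
  - by move=> v /=; rewrite in_itv/=; exact: le_price.
rewrite ge0_integralZl//.
by rewrite [leRHS]EFinM; apply: lee_wpmul2l; [rewrite lee_fin|exact: C'w].
Qed.

End Verification.

(** * Plans made of a gulp and an exponential rate *)

Section GulpThenExponentialRate.
Context {R : realType} {T : R} (T_gt0 : 0 < T).
Variables (g a b c lam : R).
Hypotheses (g_ge0 : 0 <= g) (c_ge0 : 0 <= c) (a_ge0 : 0 <= a) (ab : a <= b) (bT : b <= T).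
Implicit Types (s t : R).

(** The clock of consumption: it runs on [lo, hi] only, and stands still before and
    after.  It turns formulas with three phases into a single one. *)
Definition clamp (lo hi t : R) : R := Num.max lo (Num.min t hi).

Lemma clamp_le lo hi s t : s <= t -> clamp lo hi s <= clamp lo hi t.
Proof. by move=> st; rewrite /clamp ge_max le_max lexx/= le_max le_min !ge_min st lexx !orbT. Qed.

Lemma continuous_clamp lo hi : continuous (clamp lo hi).
Proof.
move=> t; apply: (@continuous_max _ _ (fun=> lo) (fun x => Num.min x hi)).
  exact: cvg_cst.
by apply: (@continuous_min _ _ id (fun=> hi)); [exact: cvg_id|exact: cvg_cst].
Qed.

Lemma itvoc_clamp s t : `]s, t] `&` `]a, b] = `]clamp a b s, clamp a b t]%classic.
Proof.
apply/seteqP; split => x /=; rewrite !in_itv/= /clamp gt_max gt_min le_max le_min.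
- by move=> [/andP[sx xt] /andP[ax xb]]; rewrite ax sx xt xb/= orbT.
- move=> /andP[/andP[ax sbx] /orP[xa|/andP[xt xb]]].
    by move: ax; rewrite ltNge xa.
  by rewrite ax xt xb; move: sbx => /orP[->|]//; rewrite ltNge xb.
Qed.

Lemma integral_exp_clamp s t : s <= t ->
  (\int[lebesgue_measure]_(x in `]s, t] `&` `]a, b]) (c * expR (- lam * x))%:E =
   (c * (exp_primitive lam (clamp a b t) - exp_primitive lam (clamp a b s)))%:E)%E.
Proof.
move=> st; rewrite itvoc_clamp; under eq_integral do rewrite EFinM.
rewrite ge0_integralZl//.
  by rewrite integral_exp ?clamp_le// EFinM.
by apply/measurable_EFinP; exact: measurable_expRM.
Qed.

Definition gulp_exp_fun t := g + c * (exp_primitive lam (clamp a b t) - exp_primitive lam a).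

Lemma clamp_ge lo hi t : lo <= clamp lo hi t.
Proof. by rewrite le_max lexx. Qed.

Let gulp_exp_ge0 t : 0 <= t <= T -> 0 <= gulp_exp_fun t.
Proof.
by move=> _; rewrite addr_ge0// mulr_ge0// subr_ge0 exp_primitive_le// clamp_ge.
Qed.

Let gulp_exp_nd s t : 0 <= s -> s <= t -> t <= T -> gulp_exp_fun s <= gulp_exp_fun t.
Proof.
by move=> _ st _; rewrite lerD2l ler_wpM2l// lerD2r exp_primitive_le// clamp_le.
Qed.

Lemma continuous_gulp_exp_fun : continuous gulp_exp_fun.
Proof.
move=> t; apply: cvgD; first exact: cvg_cst.
apply: cvgM; first exact: cvg_cst.
apply: cvgB; last exact: cvg_cst.
apply: (@continuous_comp _ _ _ (clamp a b) (exp_primitive lam)); first exact: continuous_clamp.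
exact: continuous_exp_primitive.
Qed.

Let gulp_exp_rc t : 0 <= t < T -> gulp_exp_fun x @[x --> t^'+] --> gulp_exp_fun t.
Proof. by move=> _; apply: cvg_at_right_filter; exact: continuous_gulp_exp_fun. Qed.

Definition gulp_exp_plan : plan T_gt0 := Plan T_gt0 gulp_exp_ge0 gulp_exp_nd gulp_exp_rc.

Local Notation C := gulp_exp_plan.

Lemma gulp_exp_plan_rate :
  gulp_then_rate g a b (fun t => c * expR (- lam * t)) C.
Proof.
move=> t /andP[t0 tT] /=; congr (_ + _).
rewrite (_ : `]a, b] `&` `[0, t] = `](-1), t] `&` `]a, b]); last first.
  apply/seteqP; split => x /=; rewrite !in_itv/=.
  - by move=> [/andP[-> ->] /andP[x0 ->]]; rewrite (lt_le_trans _ x0).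
  - move=> [/andP[_ ->] /andP[ax ->]]; rewrite ax (le_trans a_ge0)//.
    exact: ltW.
rewrite /Rintegral integral_exp_clamp ?(le_trans _ t0)//=.
have -> // : clamp a b (-1) = a.
rewrite /clamp; apply/max_idPl; rewrite ge_min; apply/orP; left.
exact: le_trans a_ge0.
Qed.

Let rate s := if (a < s) && (s <= b) then c * expR (- lam * s) else 0.

Let measurable_rate : measurable_fun setT rate.
Proof.
apply: measurable_fun_ifT => //.
- by apply: measurable_and; [apply: measurable_fun_ltr|apply: measurable_fun_ler].
- by apply: measurable_funM => //; exact: measurable_expRM.
Qed.

Let rate_ge0 s : 0 <= rate s.
Proof. by rewrite /rate; case: ifP => // _; rewrite mulr_ge0 ?expR_ge0. Qed.

(** A Lebesgue-Stieltjes measure is determined by its values on half-open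
   intervals; this identifies dC, and with it all integrals against dC. *)
Let mu := measure_add (mscale (NngNum g_ge0) \d_(0 : measurableTypeR R))
  (density lebesgue_measure measurable_rate rate_ge0).

Lemma clamp_le0 t : t <= 0 -> clamp a b t = a.
Proof.
move=> t0; apply/max_idPl; rewrite ge_min; apply/orP; left; exact: le_trans a_ge0.
Qed.

Let plan_extE t : plan_ext C t =
  (0 <= t)%R%:R * g + c * (exp_primitive lam (clamp a b t) - exp_primitive lam a).
Proof.
rewrite /plan_ext; have [t0|t0] := ltP t 0.
  by rewrite clamp_le0 ?(ltW t0)// subrr mulr0 mul0r addr0.
by rewrite mul1r /= /gulp_exp_fun /clamp -minA (min_idPr bT).
Qed.

Let integral_rate D : (\int[lebesgue_measure]_(x in D) (rate x)%:E =
  \int[lebesgue_measure]_(x in D `&` `]a, b]) (c * expR (- lam * x))%:E)%E.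
Proof.
rewrite [RHS]integral_mkcondr; apply: eq_integral => x _.
by rewrite /rate patchE mem_setE in_itv/=; case: ifP.
Qed.

Let muE A : mu A = ((g * (0 \in A)%:R)%:E +
  \int[lebesgue_measure]_(x in A) (rate x)%:E)%E.
Proof.
by rewrite /mu measure_addE; congr (_ + _)%E.
Qed.

Let plan_measureE A : measurable A -> plan_measure C A = mu A.
Proof.
apply: lebesgue_stieltjes_measure_unique => X [[s t] _ <-]/=.
have [st|ts] := leP s t; last first.
  by rewrite set_itv_ge ?bnd_simp -?leNgt ?(ltW ts)// !measure0.
rewrite lebesgue_stieltjes_itvoc//= [RHS]muE mem_setE in_itv/=.
rewrite integral_rate integral_exp_clamp// !plan_extE.
congr EFin; have [t0|t0] := leP 0 t; have [s0|s0] := leP 0 s => /=; try ring.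
by move: t0; rewrite ltNge (le_trans s0 st).
Qed.

Lemma integral_gulp_exp_plan (D : set R) (h : R -> R) : measurable D ->
  measurable_fun D h -> (forall x, D x -> 0 <= h x) ->
  (\int[plan_measure C]_(x in D) (h x)%:E = (g * (0 \in D)%:R * h 0)%:E +
   \int[lebesgue_measure]_(x in D `&` `]a, b]) (c * expR (- lam * x) * h x)%:E)%E.
Proof.
move=> mD mh h0.
have mh' : measurable_fun D (EFin \o h) by exact/measurable_EFinP.
rewrite (@eq_measure_integral _ _ _ _ mu); last first.
  by move=> A mA _; exact: plan_measureE.
rewrite ge0_integral_measure_add//.
congr (_ + _)%E.
  rewrite ge0_integral_mscale//.
  by rewrite integral_dirac//= diracE -!EFinM mulrA.
rewrite ge0_integral_density// [RHS]integral_mkcondr; apply: eq_integral => x _.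
rewrite /rate patchE mem_setE in_itv/=; case: ifP => _; last by rewrite mulr0.
by rewrite mulrC.
Qed.

End GulpThenExponentialRate.

(** * Shadow values of the candidate plan *)

Section CandidatePlan.
Context {R : realType} {T : R} (T_gt0 : 0 < T).
Variables (w y beta r delta alpha : R).
Variables (g t0 b A : R).
Hypotheses (y_gt0 : 0 < y) (beta_gt0 : 0 < beta) (delta_gt0 : 0 < delta)
  (alpha_gt0 : 0 < alpha).

Local Notation kappa := (r + beta / alpha - delta).
Local Notation theta := (delta + beta * (1 - alpha^-1)).
Local Notation N := (r + beta).
Local Notation c := (alpha * kappa / beta * A).

Hypotheses (kappa_gt0 : 0 < kappa) (N_gt0 : 0 < N) (A_gt0 : 0 < A)
  (g_ge0 : 0 <= g) (c_ge0 : 0 <= c) (t0_ge0 : 0 <= t0) (t0b : t0 <= b) (bT : b <= T).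
(** A gulp is only compatible with starting to consume at once: it is optimal where
   the shadow value equals the price, and before t0 it is smaller. *)
Hypothesis gulp_or_wait : g = 0 \/ t0 = 0.
Hypothesis target_level : y + beta * g = A * expR (alpha * kappa * t0).
(** The integral of e^{-theta s} over [b, T] is e^{-theta b} / N: the utility accrued
   after consumption stops equals the shadow price at that time. *)
Hypothesis terminal_shadow :
  exp_primitive theta T - exp_primitive theta b = expR (- theta * b) / N.
Hypothesis spends_wealth :
  g + c * (exp_primitive (alpha * (delta - r) + r) b -
           exp_primitive (alpha * (delta - r) + r) t0) = w.

Definition candidate := gulp_exp_plan T_gt0 t0 b (alpha * (delta - r)) g_ge0 c_ge0.

Local Notation C := candidate.
Local Notation cl := (clamp t0 b).

Let alpha_neq0 : alpha != 0. Proof. exact: lt0r_neq0. Qed.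
Let beta_neq0 : beta != 0. Proof. exact: lt0r_neq0. Qed.
Let kappa_neq0 : kappa != 0. Proof. exact: lt0r_neq0. Qed.

Let itv0 s : `[0, s] `&` `]t0, b] = `](-1), s] `&` `]t0, b].
Proof.
apply/seteqP; split => x /=; rewrite !in_itv/=.
- by move=> [/andP[x0 ->] ->]; rewrite (lt_le_trans _ x0).
- by move=> [/andP[_ ->] /andP[ax ->]]; rewrite ax (le_trans t0_ge0)//; exact: ltW.
Qed.

Let clampN1 : cl (-1) = t0. Proof. by apply: clamp_le0 => //; rewrite lerN10. Qed.

Lemma candidate_discounted s : 0 <= s <= T -> discounted_consumption beta C s =
  (expR (- beta * s) *
   (g + A / beta * (expR (alpha * kappa * cl s) - expR (alpha * kappa * t0))))%:E.
Proof.
move=> /andP[s0 sT].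
rewrite /discounted_consumption integral_gulp_exp_plan//; last exact: measurable_discount.
have -> : (0 \in `[0, s]%classic) = true by rewrite mem_setE in_itv/= lexx.
rewrite itv0.
have c'0 : 0 <= c * expR (- beta * s) by rewrite mulr_ge0 ?expR_ge0.
have e x : c * expR (- (alpha * (delta - r)) * x) * expR (- beta * (s - x)) =
    c * expR (- beta * s) * expR (- (- (alpha * kappa)) * x).
  rewrite -!mulrA -!expRD; do !congr (_ * _); congr expR.
  by field; rewrite alpha_neq0.
under eq_integral do rewrite e.
rewrite (integral_exp_clamp _ _ _ c'0); last by rewrite (le_trans _ s0).
rewrite clampN1 -EFinD; congr EFin.
rewrite !exp_primitiveE ?oppr_eq0 ?mulf_neq0// !opprK subr0 mulr1.
move: kappa_neq0; generalize kappa => k k0.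
by field; rewrite beta_neq0 alpha_neq0 k0.
Qed.

(** The rate is chosen so that Y decays at rate alpha (delta - r) while the clock
    runs, as beta - alpha kappa = alpha (delta - r), and at rate beta otherwise. *)
Lemma candidate_satisfaction s : 0 <= s <= T ->
  satisfaction y beta C s = A * expR (- beta * s + alpha * kappa * cl s).
Proof.
move=> sT; rewrite satisfactionE candidate_discounted//= expRD.
transitivity (expR (- beta * s) * (y + beta * g +
  A * (expR (alpha * kappa * cl s) - expR (alpha * kappa * t0)))).
  by field.
by rewrite target_level; ring.
Qed.

(** As theta + kappa = N, this is proportional to e^{-N s} while the clock runs. *)
Lemma candidate_marginal_utility s : 0 <= s <= T ->
  marginal_utility y beta delta alpha C s * expR (- beta * s) =
  delta * A `^ (- alpha^-1) * expR (- theta * s - kappa * cl s).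
Proof.
move=> sT; rewrite /marginal_utility candidate_satisfaction//.
have -> : 1 - alpha^-1 - 1 = - alpha^-1 by ring.
rewrite powRM ?expR_ge0 ?(ltW A_gt0)// [expR _ `^ _]/powR gt_eqF ?expR_gt0// expRK.
transitivity (delta * A `^ (- alpha^-1) * (expR (delta * (0 - s)) *
  expR (- alpha^-1 * (- beta * s + alpha * kappa * cl s)) * expR (- beta * s))).
  by ring.
rewrite -!expRD; congr (_ * expR _); field; exact: alpha_neq0.
Qed.

(** Up to a constant, the shadow value at v without the factor e^{beta v}. *)
Let tail v := (\int[lebesgue_measure]_(s in `[v, T]) (expR (- theta * s - kappa * cl s))%:E)%E.

Let measurable_tail (D : set R) : measurable_fun D (fun s => expR (- theta * s - kappa * cl s)).
Proof.
apply: measurable_funTS; apply: measurableT_comp => //; apply: measurable_funB.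
  exact: measurable_funM.
apply: measurable_funM => //; apply: continuous_measurable_fun; exact: continuous_clamp.
Qed.

Lemma candidate_shadow_value v : 0 <= v ->
  shadow_value (T := T) beta (marginal_utility y beta delta alpha C) v =
  ((delta * A `^ (- alpha^-1) * expR (beta * v))%:E * tail v)%E.
Proof.
move=> v0; set k := delta * _ * _.
have k0 : 0 <= k by rewrite !mulr_ge0 ?expR_ge0 ?powR_ge0// ltW.
transitivity (\int[lebesgue_measure]_(s in `[v, T])
    (k%:E * (expR (- theta * s - kappa * cl s))%:E))%E; last first.
  apply: ge0_integralZl.
  - exact: measurable_itv.
  - by apply/measurable_EFinP; exact: measurable_tail.
  - by move=> s _; rewrite lee_fin expR_ge0.
  - by rewrite lee_fin.
apply: eq_integral => s; rewrite inE/= in_itv/= => /andP[vs sT].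
rewrite -EFinM; congr EFin.
transitivity (marginal_utility y beta delta alpha C s * expR (- beta * s) * expR (beta * v)).
  by rewrite -mulrA -expRD; congr (_ * _); congr expR; ring.
rewrite candidate_marginal_utility ?(le_trans v0)//.
by rewrite /k mulrAC.
Qed.

Let tail_stop v : b <= v -> v <= T ->
  tail v = (expR (- kappa * b) * (exp_primitive theta T - exp_primitive theta v))%:E.
Proof.
move=> bv vT; rewrite EFinM -integral_exp// -ge0_integralZl//; last first.
  by apply/measurable_EFinP; exact: measurable_expRM.
rewrite integral_itv_obnd_cbnd; last first.
  by apply/measurable_EFinP; apply: measurable_funM => //; exact: measurable_expRM.
apply: eq_integral => s; rewrite inE/= in_itv/= => /andP[vs sT].
have -> : cl s = b by rewrite /clamp (min_idPr (le_trans bv vs)) (max_idPr t0b).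
by rewrite -EFinM -expRD; congr (expR _)%:E; ring.
Qed.

Let theta_kappa : theta + kappa = N. Proof. by field; exact: alpha_neq0. Qed.

Let terminal_tail : expR (- kappa * b) * (exp_primitive theta T - exp_primitive theta b) =
  expR (- N * b) / N.
Proof.
rewrite terminal_shadow mulrA -expRD.
have -> // : - kappa * b + - theta * b = - N * b by rewrite -theta_kappa; ring.
Qed.

Let exp_primitiveN u v : exp_primitive N v - exp_primitive N u =
  (expR (- N * u) - expR (- N * v)) / N.
Proof. by rewrite !exp_primitiveE ?lt0r_neq0// -mulrBl; congr (_ / _); ring. Qed.

Let tail_split v : v <= b -> tail v =
  (\int[lebesgue_measure]_(s in `]v, b]) (expR (- theta * s - kappa * cl s))%:E +
   (expR (- N * b) / N)%:E)%E.
Proof.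
move=> vb; rewrite -terminal_tail -tail_stop// /tail.
have m_tail (D : set R) : measurable_fun D (fun s => (expR (- theta * s - kappa * cl s))%:E).
  by apply/measurable_EFinP; exact: measurable_tail.
rewrite -(integral_itv_obnd_cbnd (m_tail `]v, T]%classic)).
rewrite -(integral_itv_obnd_cbnd (m_tail `]b, T]%classic)).
rewrite (@itv_bndbnd_setU _ _ _ (BRight b)) ?bnd_simp//.
apply: ge0_integral_setU.
- exact: measurable_itv.
- exact: measurable_itv.
- exact: m_tail.
- by move=> s _; rewrite lee_fin expR_ge0.
- apply/disj_setPS => s [/=]; rewrite !in_itv/= => /andP[_ sb] /andP[].
  by rewrite ltNge sb.
Qed.

(** On [t0, b] the clock shows the current time, and the terminal part is the
   integral of e^{-N s} over [b, +oo[; so the tail is that over [v, +oo[. *)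
Let tail_eq v : t0 <= v <= b -> tail v = (expR (- N * v) / N)%:E.
Proof.
move=> /andP[t0v vb]; rewrite tail_split//.
transitivity (\int[lebesgue_measure]_(s in `]v, b]) (expR (- N * s))%:E +
   (expR (- N * b) / N)%:E)%E; last first.
  by rewrite integral_exp// exp_primitiveN -EFinD -mulrDl subrK.
apply: (f_equal (fun u => u + _)%E).
apply: eq_integral => s; rewrite inE/= in_itv/= => /andP[vs sb].
have -> : cl s = s.
  by rewrite /clamp (min_idPl sb) (max_idPr _)// (le_trans t0v)// ltW.
have -> // : - theta * s - kappa * s = - N * s by rewrite -theta_kappa; ring.
Qed.

(** Before b the clock is never late, which makes the integrand at most e^{-N s}.
   After b it is late: starting from equality at b, the tail then loses more than
   the integral of e^{-N s} over [v, +oo[ does. *)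
Let tail_le v : 0 <= v <= T -> (tail v <= (expR (- N * v) / N)%:E)%E.
Proof.
move=> /andP[v0 vT]; have [vb|bv] := leP v b.
  rewrite tail_split//.
  have -> : ((expR (- N * v) / N)%:E =
      \int[lebesgue_measure]_(s in `]v, b]) (expR (- N * s))%:E +
      (expR (- N * b) / N)%:E)%E.
    by rewrite integral_exp// exp_primitiveN -EFinD -mulrDl subrK.
  apply: leeD => //; apply: ge0_le_integral.
  - exact: measurable_itv.
  - by move=> s _; rewrite lee_fin expR_ge0.
  - by apply/measurable_EFinP; exact: measurable_tail.
  - by apply/measurable_EFinP; exact: measurable_expRM.
  - move=> s /=; rewrite in_itv/= => /andP[vs sb].
    have -> : - N * s = - theta * s - kappa * s by rewrite -theta_kappa; ring.
    rewrite lee_fin ler_expR lerD2l lerN2 ler_pM2l//.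
    by rewrite le_max le_min lexx sb orbT.
rewrite tail_stop// ?(ltW bv)// lee_fin.
have h : exp_primitive N v - exp_primitive N b <=
    expR (- kappa * b) * (exp_primitive theta v - exp_primitive theta b).
  rewrite -lee_fin [leRHS]EFinM -!integral_exp ?(ltW bv)//.
  rewrite -ge0_integralZl//; last by apply/measurable_EFinP; exact: measurable_expRM.
  apply: ge0_le_integral.
  - exact: measurable_itv.
  - by move=> s _; rewrite lee_fin expR_ge0.
  - by apply/measurable_EFinP; exact: measurable_expRM.
  - by apply: measurable_funeM; apply/measurable_EFinP; exact: measurable_expRM.
  - move=> s /=; rewrite in_itv/= => /andP[bs _].
    have -> : - N * s = - kappa * s + - theta * s by rewrite -theta_kappa; ring.
    rewrite -EFinM lee_fin -expRD ler_expR lerD2r !mulNr lerN2 ler_pM2l//.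
    exact: ltW.
move: h terminal_tail; rewrite exp_primitiveN mulrBl.
set x := exp_primitive theta T; set x1 := exp_primitive theta v.
set x2 := exp_primitive theta b; set k := expR (- kappa * b).
set p := _ / N; set p' := _ / N; move=> h e.
have -> : k * (x - x1) = k * (x - x2) - k * (x1 - x2) by ring.
rewrite e; lra.
Qed.

(** The Lagrange multiplier of the budget constraint, up to the factor beta. *)
Definition price_multiplier := delta * A `^ (- alpha^-1) / N.

Let multiplier_ge0 : 0 <= price_multiplier.
Proof. by rewrite divr_ge0 ?mulr_ge0 ?powR_ge0// ltW. Qed.

Let price_factor v : delta * A `^ (- alpha^-1) * expR (beta * v) * (expR (- N * v) / N) =
  price_multiplier * expR (- r * v).
Proof.
have -> : - r * v = beta * v + - N * v by ring.
by rewrite expRD /price_multiplier; field; exact: lt0r_neq0.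
Qed.

Local Notation sv := (shadow_value (T := T) beta (marginal_utility y beta delta alpha C)).

Lemma candidate_shadow_le v : 0 <= v <= T -> (sv v <= (price_multiplier * expR (- r * v))%:E)%E.
Proof.
move=> vT; have /andP[v0 _] := vT; rewrite candidate_shadow_value// -price_factor [leRHS]EFinM.
apply: lee_wpmul2l; last exact: tail_le.
by rewrite lee_fin !mulr_ge0 ?expR_ge0 ?powR_ge0// ltW.
Qed.

Lemma candidate_shadow_eq v : t0 <= v <= b -> sv v = (price_multiplier * expR (- r * v))%:E.
Proof.
move=> vb; have /andP[tv _] := vb.
by rewrite candidate_shadow_value ?(le_trans t0_ge0)// tail_eq// -price_factor -EFinM.
Qed.

Local Notation eta := (alpha * (delta - r) + r).

Lemma candidate_cost :
  (\int[plan_measure C]_(t in `[0%R, T]) (expR (- r * t))%:E = w%:E)%E.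
Proof.
rewrite integral_gulp_exp_plan//; last exact: measurable_expRM.
have -> : (0 \in `[0, T]%classic) = true by rewrite mem_setE in_itv/= lexx ltW.
have e x : c * expR (- (alpha * (delta - r)) * x) * expR (- r * x) = c * expR (- eta * x).
  by rewrite -mulrA -expRD; congr (_ * expR _); ring.
rewrite itv0; under eq_integral do rewrite e.
rewrite (integral_exp_clamp _ _ _ c_ge0); last by rewrite (le_trans _ (ltW T_gt0))// lerN10.
rewrite clampN1 /clamp (min_idPr bT) (max_idPr t0b) -EFinD mulr0 expR0 !mulr1.
by rewrite spends_wealth.
Qed.

(** The shadow value where the plan consumes and 0 elsewhere.  Being explicit and
   below the shadow value, it suffices for the lower bound. *)
Let supported v := if (t0 <= v) && (v <= b) then price_multiplier * expR (- r * v) else 0.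

Lemma candidate_shadow_spent : ((price_multiplier * w)%:E <=
  \int[plan_measure C]_(v in `[0%R, T]) sv v)%E.
Proof.
have ms (D : set R) : measurable_fun D supported.
  apply: measurable_funTS; apply: measurable_fun_ifT => //.
  - by apply: measurable_and; apply: measurable_fun_ler.
  - by apply: measurable_funM => //; exact: measurable_expRM.
have s0 v : 0 <= supported v.
  by rewrite /supported; case: ifP => // _; rewrite mulr_ge0 ?expR_ge0.
have -> : ((price_multiplier * w)%:E = \int[plan_measure C]_(v in `[0%R, T]) (supported v)%:E)%E.
  rewrite integral_gulp_exp_plan//.
  have -> : (0 \in `[0, T]%classic) = true by rewrite mem_setE in_itv/= lexx ltW.
  rewrite itv0 -spends_wealth.
  transitivity ((price_multiplier * g)%:E + \int[lebesgue_measure]_(x in `](-1)%R, T] `&` `]t0, b])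
      (price_multiplier * c * expR (- eta * x))%:E)%E.
    rewrite (integral_exp_clamp _ _ _ (mulr_ge0 multiplier_ge0 c_ge0)); last first.
      by rewrite (le_trans _ (ltW T_gt0))// lerN10.
    rewrite clampN1 /clamp (min_idPr bT) (max_idPr t0b) -EFinD; congr EFin; ring.
  congr (_ + _)%E.
    congr EFin; rewrite mulr1; case: gulp_or_wait => [->|t00]; first by rewrite mul0r mulr0.
    by rewrite /supported t00 lexx -[X in X <= _]t00 t0b mulr0 expR0 mulr1 mulrC.
  apply: eq_integral => x; rewrite inE/= !in_itv/= => -[_ /andP[tx xb]].
  rewrite /supported (ltW tx) xb/=; congr EFin.
  have -> : - eta * x = - (alpha * (delta - r)) * x + - r * x by ring.
  by rewrite expRD; ring.
apply: ge0_le_integral.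
- exact: measurable_itv.
- by move=> v _; rewrite lee_fin.
- by apply/measurable_EFinP; exact: ms.
- apply: measurable_shadow_value; first exact: measurable_marginal_utility.
  by move=> s; exact: marginal_utility_ge0.
- move=> v _; rewrite /supported; case: ifPn => [vb|_]; first by rewrite candidate_shadow_eq.
  by apply: shadow_value_ge0 => s; exact: marginal_utility_ge0.
Qed.

Theorem candidate_optimal rho : rho != 1 -> rho < alpha^-1 -> alpha^-1 != 1 ->
  optimal w r y beta delta rho alpha C.
Proof.
move=> rho1 rho_lt alpha1.
have a0 : 1 - alpha^-1 != 0 by rewrite subr_eq0 eq_sym.
have a1 : 1 - alpha^-1 < 1 by rewrite ltrBlDr ltrDl invr_gt0.
apply: (shadow_price_optimal y_gt0 beta_gt0 delta_gt0 a0 a1 rho1 rho_lt multiplier_ge0).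
- by rewrite /budget_set/= candidate_cost.
- exact: candidate_shadow_le.
- exact: candidate_shadow_spent.
Qed.

End CandidatePlan.

(** * The stopping time and the cost of waiting *)

Section Constants.
Context {R : realType}.
Variables (T w y beta r delta alpha : R).
Hypotheses (y_gt0 : 0 < y) (beta_gt0 : 0 < beta) (r_ge0 : 0 <= r)
  (alpha_gt0 : 0 < alpha).

Local Notation kappa := (r + beta / alpha - delta).
Local Notation theta := (delta + beta * (1 - alpha^-1)).
Local Notation N := (r + beta).
Local Notation eta := (alpha * (delta - r) + r).
Local Notation tau := (tau_bar T r beta delta alpha).

Hypothesis kappa_gt0 : 0 < kappa.

Let alpha_neq0 : alpha != 0. Proof. exact: lt0r_neq0. Qed.
Let beta_neq0 : beta != 0. Proof. exact: lt0r_neq0. Qed.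
Let kappa_neq0 : kappa != 0. Proof. exact: lt0r_neq0. Qed.
Let N_gt0 : 0 < N. Proof. exact: ltr_wpDl. Qed.
Let N_neq0 : N != 0. Proof. exact: lt0r_neq0. Qed.

(** Solved for tau_bar, this is its definition: it reads T - tau_bar = 1/N if
    theta = 0, and e^{-theta (T - tau_bar)} = kappa/N otherwise. *)
Lemma tau_bar_terminal_shadow :
  exp_primitive theta T - exp_primitive theta tau = expR (- theta * tau) / N.
Proof.
have tk : theta + kappa = N by field.
have [th0|th0] := eqVneq theta 0.
  by rewrite /exp_primitive /tau_bar th0 eqxx /= oppr0 mul0r expR0 opprB addrC subrK div1r.
have tauE : - theta * T = - theta * tau + ln (kappa / N).
  rewrite /tau_bar th0 -invf_div lnV ?posrE ?divr_gt0//.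
  move: th0; generalize theta => u u0; field; exact: u0.
rewrite !exp_primitiveE// -mulrBl tauE expRD lnK ?posrE ?divr_gt0//.
have e : kappa = N - theta by field.
rewrite [X in 1 - _ * (X / N)]e.
move: th0 N_neq0; generalize theta N => u n u0 n0.
by field; rewrite u0 n0.
Qed.

(** The integral of a positive function from tau_bar to T is positive, hence
    tau_bar cannot exceed T. *)
Lemma tau_bar_le : tau <= T.
Proof.
rewrite leNgt; apply/negP => /ltW /(exp_primitive_le theta).
rewrite -subr_le0 tau_bar_terminal_shadow leNgt.
by rewrite divr_gt0// expR_gt0.
Qed.

Lemma etaE : alpha * (delta - (1 - alpha^-1) * r) = eta.
Proof. by field. Qed.

Lemma eta_eq0 : (delta == (1 - alpha^-1) * r) = (eta == 0).
Proof. by rewrite -etaE mulf_eq0 (negbTE alpha_neq0)/= subr_eq0. Qed.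

(** So k* is the cost of consuming from 0 until tau_bar when the initial level,
    just after the gulp, is 1. *)
Lemma k_starE :
  k_star T r beta delta alpha = alpha * kappa / beta * exp_primitive eta tau.
Proof.
rewrite /k_star eta_eq0 /exp_primitive; case: ifPn => [eta0|/negPn/eqP eta0].
  rewrite (negbTE eta0).
  have -> : alpha * delta + (1 - alpha) * r = eta by ring.
  have -> : delta - (1 - alpha^-1) * r = eta / alpha by rewrite -etaE; field.
  move: eta0; generalize kappa eta tau => u v t v0.
  by field; rewrite v0 beta_neq0 alpha_neq0.
rewrite eta0 eqxx; congr (_ * _); field; by rewrite beta_neq0 alpha_neq0.
Qed.

(** The wealth that finances waiting until a and consuming from a to tau_bar: the
    level has decayed to y e^{-beta a} = (y e^{-alpha kappa a}) e^{-lambda a} by then. *)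
Definition waiting_cost a : R := alpha * kappa / beta *
  (y * expR (- (alpha * kappa) * a) * (exp_primitive eta tau - exp_primitive eta a)).

Lemma continuous_waiting_cost : continuous waiting_cost.
Proof.
move=> a; apply: cvgM; first exact: cvg_cst.
apply: cvgM.
  apply: cvgM; first exact: cvg_cst.
  exact: (@continuous_expRM _ (alpha * kappa)).

by apply: cvgB; [exact: cvg_cst|exact: continuous_exp_primitive].
Qed.

Let rate_gt0 : 0 < alpha * kappa / beta.
Proof. by rewrite divr_gt0// mulr_gt0. Qed.

(** Waiting longer lowers the level to be maintained and shortens the time during
    which it is.  Beyond tau_bar, where the cost is negative, these two effects
    oppose each other. *)
Lemma waiting_cost_lt a a' : a < a' -> 0 < waiting_cost a' ->
  waiting_cost a' < waiting_cost a.
Proof.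
move=> aa'; rewrite /waiting_cost pmulr_rgt0// ltr_pM2l//.
have e0 x : 0 < y * expR (- (alpha * kappa) * x) by rewrite mulr_gt0 ?expR_gt0.
rewrite pmulr_rgt0// => h; apply: ltr_pM => //.
- exact: ltW.
- exact: ltW.
- by rewrite ltr_pM2l// ltr_expR !mulNr ltrN2 ltr_pM2l// mulr_gt0.
- by rewrite ltrD2l ltrN2 exp_primitive_lt.
Qed.

Lemma waiting_cost_inj a a' : 0 < w -> waiting_cost a = w -> waiting_cost a' = w -> a = a'.
Proof.
move=> w0 aw a'w; have [aa'|aa'|//] := ltgtP a a'.
- by have := waiting_cost_lt aa'; rewrite aw a'w w0 ltxx => /(_ isT).
- by have := waiting_cost_lt aa'; rewrite aw a'w w0 ltxx => /(_ isT).
Qed.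

Lemma waiting_cost_ivt : 0 < tau -> 0 < w -> w < k_star T r beta delta alpha * y ->
  exists2 a, 0 <= a <= tau & waiting_cost a = w.
Proof.
move=> tau0 w0 wk.
have f0 : waiting_cost 0 = k_star T r beta delta alpha * y.
  by rewrite /waiting_cost k_starE mulr0 expR0 exp_primitive0; ring.
have ftau : waiting_cost tau = 0 by rewrite /waiting_cost subrr !mulr0.
have [] := @IVT R waiting_cost 0 tau w (ltW tau0).
- by apply: continuous_subspaceT; exact: continuous_waiting_cost.
- by rewrite f0 ftau ge_min le_max (ltW w0) (ltW wk) orbT.
- by move=> a; rewrite in_itv/= => a0 aw; exists a.
Qed.

(** The date tau_under, as a function of K = M (r + beta) / beta. *)
Definition waiting_time K : R := kappa^-1 * ln (K * y `^ alpha^-1).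

Lemma ln_waiting_time K : 0 < K -> ln K = kappa * waiting_time K - alpha^-1 * ln y.
Proof.
move=> K0; rewrite /waiting_time mulrA mulfV// mul1r lnM ?posrE ?powR_gt0//.
by rewrite ln_powR addrK.
Qed.

Lemma waiting_time_inj K K' : 0 < K -> 0 < K' -> waiting_time K = waiting_time K' -> K = K'.
Proof.
move=> K0 K'0 e; apply: ln_inj; rewrite ?posrE//.
by rewrite (ln_waiting_time K0) (ln_waiting_time K'0) e.
Qed.

Lemma waiting_time_surj a : exists2 K, 0 < K & waiting_time K = a.
Proof.
exists (expR (kappa * a - alpha^-1 * ln y)); first exact: expR_gt0.
rewrite /waiting_time lnM ?posrE ?expR_gt0 ?powR_gt0// expRK ln_powR subrK.
by rewrite mulKf.
Qed.

(** The coefficient A of the candidate that starts at a with level y e^{-beta a}. *)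
Lemma powR_waiting_time K : 0 < K ->
  K `^ (- alpha) = y * expR (- (alpha * kappa) * waiting_time K).
Proof.
move=> K0; rewrite /powR gt_eqF// (ln_waiting_time K0).
rewrite -[y in RHS]lnK ?posrE// -expRD; congr expR.
by generalize kappa => k; field.
Qed.

Lemma K_equationP K : 0 < K ->
  K_equation T r beta delta alpha w y K <-> waiting_cost (waiting_time K) = w.
Proof.
move=> K0; rewrite /K_equation eta_eq0 /waiting_cost powR_waiting_time//.
set a := waiting_time K.
have eK : beta + alpha * (r - delta) = alpha * kappa by field.
rewrite /exp_primitive; case: ifPn => [eta0|/negPn/eqP eta0].
  rewrite (negbTE eta0) eK.
  have -> : alpha * delta - (alpha - 1) * r = eta by ring.
  have -> : K `^ (- (N / kappa)) * y `^ (- (eta / (alpha * kappa))) =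
      y * expR (- (alpha * kappa) * a) * expR (- eta * a).
    rewrite /powR !gt_eqF// (ln_waiting_time K0) -/a.
    rewrite -[y in RHS]lnK ?posrE// -!expRD; congr expR.
    have -> : N = eta + alpha * kappa by field.
    move: kappa_neq0; generalize kappa => k k0; field.
    by rewrite k0 alpha_neq0.
  rewrite -mulrBr -mulrBl.
  set X := y * _.
  have -> : alpha * kappa / beta * (X * ((1 - expR (- eta * tau) - (1 - expR (- eta * a))) / eta)) =
    alpha * kappa / (beta * eta) * (X * (expR (- eta * a) - expR (- eta * tau))).
    by rewrite invfM; ring.
  have -> : beta * eta / (alpha * kappa) = (alpha * kappa / (beta * eta))^-1 by rewrite invf_div.
  have d0 : alpha * kappa / (beta * eta) != 0.
    by rewrite mulf_neq0 ?invr_eq0 ?mulf_neq0.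
  split=> [->|<-]; first by rewrite mulVKf.
  by rewrite mulKf.
rewrite eta0 eqxx (ln_waiting_time K0) -/a.
have -> : beta^-1 * (kappa * a - alpha^-1 * ln y) + (alpha * beta)^-1 * ln y -
   beta^-1 * kappa * tau = - (kappa / beta * (tau - a)) by rewrite invfM; ring.
set X := y * _.
have -> : alpha * kappa / beta * (X * (tau - a)) = alpha * (X * (kappa / beta * (tau - a))) by ring.
rewrite mulrN; split=> [/oppr_inj ->|<-]; first by rewrite mulVKf.
by rewrite mulKf.
Qed.

End Constants.

(** * Optimal plans *)

Theorem theorem4p6 (R : realType) (T w y beta r delta rho alpha : R)
  (T_gt0 : 0 < T) (w_gt0 : 0 < w) (y_gt0 : 0 < y) (beta_gt0 : 0 < beta)
  (r_ge0 : 0 <= r)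
  (delta_gt0 : 0 < delta) (rho_gt0 : 0 < rho) (alpha_gt0 : 0 < alpha)
  (rho_neq1 : rho != 1) (rho_lt : rho < alpha^-1) (alphaV_neq1 : alpha^-1 != 1)
  (kappa_gt0 : 0 < r + beta / alpha - delta)
  (tau_bar_gt0 : 0 < tau_bar T r beta delta alpha) :
  let tau := tau_bar T r beta delta alpha in
  let k := k_star T r beta delta alpha in
  (k * y <= w ->
   exists2 C : plan T_gt0,
     gulp_then_rate ((w - k * y) / (1 + beta * k)) 0 tau
       (fun t => (1 - alpha * (delta - r) / beta) *
                 ((y + beta * w) / (1 + beta * k)) *
                 expR (- alpha * (delta - r) * t)) C &
     optimal w r y beta delta rho alpha C) /\
  (w < k * y ->
   exists K : R,
     [/\ 0 < K,
         K_equation T r beta delta alpha w y K,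
         (forall K' : R, 0 < K' ->
            K_equation T r beta delta alpha w y K' -> K' = K) &
         let M := beta * K / (r + beta) in
         let tau0 := tau_under r beta delta alpha y M in
         0 <= tau0 <= tau /\
         exists2 C : plan T_gt0,
           gulp_then_rate 0 tau0 tau
             (fun t => (beta + alpha * (r - delta)) / beta *
                       (M * ((r + beta) / beta)) `^ (- alpha) *
                       expR (- alpha * (delta - r) * t)) C &
           optimal w r y beta delta rho alpha C]).
Proof.
move=> tau k.
have N0 : 0 < r + beta by exact: ltr_wpDl.
have ts := tau_bar_terminal_shadow T beta_gt0 r_ge0 alpha_gt0 kappa_gt0.
have tau_le : tau <= T := tau_bar_le T beta_gt0 r_ge0 alpha_gt0 kappa_gt0.
have kE := k_starE T r delta beta_gt0 alpha_gt0; rewrite -/k -/tau in kE ts.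
set kappa := r + beta / alpha - delta in kappa_gt0 ts kE.
set eta := alpha * (delta - r) + r in kE.
have c0 : 0 < alpha * kappa / beta by rewrite divr_gt0// mulr_gt0.
have k0 : 0 < k.
  by rewrite kE mulr_gt0// -(exp_primitive0 eta) exp_primitive_lt.
have bk0 : 0 < 1 + beta * k by rewrite addr_gt0// mulr_gt0.
split=> [kw|wk].
(* The level A just after the gulp and the gulp solve y + beta g = A, g + k A = w. *)
- pose A := (y + beta * w) / (1 + beta * k).
  pose g := (w - k * y) / (1 + beta * k).
  have A0 : 0 < A by rewrite divr_gt0// addr_gt0// mulr_gt0.
  have g0 : 0 <= g by rewrite divr_ge0 ?subr_ge0// ltW.
  have cA0 : 0 <= alpha * kappa / beta * A by rewrite ltW// mulr_gt0.
  exists (candidate T_gt0 0 tau g0 cA0).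
    have := gulp_exp_plan_rate T_gt0 tau (alpha * (delta - r)) g0 cA0 (lexx 0).
    congr gulp_then_rate; apply/funext => t.
    rewrite -!mulNr; congr (_ * _ * _).
    by rewrite /kappa; field; rewrite !gt_eqF.
  have target : y + beta * g = A * expR (alpha * kappa * 0).
    by rewrite mulr0 expR0 mulr1 /A /g; field; rewrite gt_eqF.
  have spent : g + alpha * kappa / beta * A *
      (exp_primitive eta tau - exp_primitive eta 0) = w.
    rewrite exp_primitive0 subr0 mulrAC -kE /A /g; field; by rewrite gt_eqF.
  exact: (candidate_optimal T_gt0 y_gt0 beta_gt0 delta_gt0 alpha_gt0 kappa_gt0 N0 A0 g0 cA0
    (lexx 0) (ltW tau_bar_gt0) tau_le (or_intror erefl) target ts spent
    rho_neq1 rho_lt alphaV_neq1).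
- have [a a_tau aw] := waiting_cost_ivt beta_gt0 alpha_gt0 tau_bar_gt0 w_gt0 wk.
  have [K K0 Ka] := waiting_time_surj y_gt0 kappa_gt0 a.
  have KP K' (K'0 : 0 < K') := K_equationP T w y_gt0 beta_gt0 alpha_gt0 kappa_gt0 K'0.
  exists K; split=> //.
  + by apply/KP => //; rewrite Ka.
  + move=> K' K'0 /(KP _ K'0) aw'; apply: (waiting_time_inj y_gt0 kappa_gt0 K'0 K0).
    rewrite Ka; exact: (waiting_cost_inj y_gt0 beta_gt0 alpha_gt0 kappa_gt0 w_gt0 aw' aw).
  move=> M tau0.
  have MK : M * ((r + beta) / beta) = K.
    by rewrite /M; field; rewrite !gt_eqF.
  have tau0E : tau0 = a by rewrite /tau0 /tau_under MK -Ka.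
  rewrite MK tau0E; split=> //; have /andP[a0 at_] := a_tau.
  have A0 : 0 < K `^ (- alpha) by rewrite powR_gt0.
  have cA0 : 0 <= alpha * kappa / beta * K `^ (- alpha) by rewrite ltW// mulr_gt0.
  exists (candidate T_gt0 a tau (lexx 0) cA0).
    have := gulp_exp_plan_rate T_gt0 tau (alpha * (delta - r)) (lexx 0) cA0 a0.
    congr gulp_then_rate; apply/funext => t.
    rewrite -!mulNr; congr (_ * _ * _).
    by rewrite /kappa; field; rewrite !gt_eqF.
  have AE := powR_waiting_time y_gt0 alpha_gt0 kappa_gt0 K0.
  have target : y + beta * 0 = K `^ (- alpha) * expR (alpha * kappa * a).
    by rewrite mulr0 addr0 AE Ka -mulrA -expRD mulNr addNr expR0 mulr1.
  have spent : 0 + alpha * kappa / beta * K `^ (- alpha) *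
      (exp_primitive eta tau - exp_primitive eta a) = w.
    by rewrite add0r AE Ka -mulrA.
  exact: (candidate_optimal T_gt0 y_gt0 beta_gt0 delta_gt0 alpha_gt0 kappa_gt0 N0 A0 (lexx 0) cA0
    a0 at_ tau_le (or_introl erefl) target ts spent rho_neq1 rho_lt alphaV_neq1).
Qed.
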